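(* Let $N\ge 1$. The set $\mathrm{Diff}(\mathbb{T}^N)\times\Omega^2(\mathbb{T}^N)$, equipped with the multiplication $$(F,\alpha)(G,\beta)=\left(FG,\ \alpha(G)+\beta+\mathrm{Tr}\left(f^{-1}\,df\wedge dg\,g^{-1}\right)\right),\qquad\text{where } f=F^J(G),\quad g=G^J,$$ for $F,G\in\mathrm{Diff}(\mathbb{T}^N)$ and $\alpha,\beta\in\Omega^2(\mathbb{T}^N)$, is a group, and it is an extension of the group $\mathrm{Diff}(\mathbb{T}^N)$ by the abelian (additive) group $\Omega^2(\mathbb{T}^N)$.
   Context: $\mathbb{T}^N=\mathbb{R}^N/\mathbb{Z}^N$ is the $N$-dimensional torus with standard coordinates $\mathbf{x}=(x_1,\dots,x_N)$. $\mathrm{Diff}(\mathbb{T}^N)$ is the group of $C^\infty$ diffeomorphisms of $\mathbb{T}^N$ under composition, $(FG)(\mathbf{x})=F(G(\mathbf{x}))$. $\Omega^2(\mathbb{T}^N)$ is the space of real $C^\infty$ differential 2-forms on $\mathbb{T}^N$. $\mathrm{Diff}(\mathbb{T}^N)$ acts on differential forms on the right by pull-back: $\alpha(G)=G^*\alpha$, i.e. $\left(a(\mathbf{x})\,dx_{j_1}\wedge\dots\wedge dx_{j_k}\right)(G)=a(G(\mathbf{x}))\,dG_{j_1}(\mathbf{x})\wedge\dots\wedge dG_{j_k}(\mathbf{x})$. For $F=(F_1,\dots,F_N)\in\mathrm{Diff}(\mathbb{T}^N)$ the jacobian $F^J$ is the smooth map $\mathbb{T}^N\to GL_N(\mathbb{R})$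 given by the matrix $F^J(\mathbf{x})=\left(\frac{\partial F_i}{\partial x_k}(\mathbf{x})\right)_{i,k=1,\dots,N}$ (well defined via local lifts of $F$ to $\mathbb{R}^N$; equivalently, the differential of $F$ under the global identification of all tangent spaces of $\mathbb{T}^N$ with $\mathbb{R}^N$). $\mathrm{Diff}(\mathbb{T}^N)$ acts on the group $\mathrm{Map}(\mathbb{T}^N,GL_N(\mathbb{R}))$ of smooth maps (with pointwise multiplication) by $m(G)(\mathbf{x})=m(G(\mathbf{x}))$, so $F^J(G)$ denotes the map $\mathbf{x}\mapsto F^J(G(\mathbf{x}))$. For smooth maps $f,g:\mathbb{T}^N\to GL_N(\mathbb{R})$, $df$ and $dg$ are the entrywise differentials (matrices of 1-forms), and in $f^{-1}\,df\wedge dg\,g^{-1}$ the matrices are multiplied by the usual rule, entries of $f^{-1}df$ and $dg\,g^{-1}$ being multiplied with the wedge product; $f^{-1}$, $g^{-1}$ are pointwise inverse matrices; $\mathrm{Tr}$ is the matrix trace, yielding a 2-form. An extension of a group $D$ by an abelian group $K$ is a group $E$ together with a short exact sequence $1\to K\to E\to D\to 1$; here the map $E\to D$ is the projection $(F,\alpha)\mapsto F$ and the map $K\to E$ is $\alpha\mapsto(\mathrm{id},\alpha)$. *)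

(* Defs.v *)
From HB Require Import structures.
From mathcomp Require Import all_boot all_order all_algebra.
From mathcomp Require Import all_classical all_reals all_analysis.

Set Implicit Arguments.
Unset Strict Implicit.
Unset Printing Implicit Defensive.

Import Order.TTheory GRing.Theory Num.Theory.
Import numFieldNormedType.Exports.

Local Open Scope classical_set_scope.
Local Open Scope quotient_scope.
Local Open Scope ring_scope.

(* Groups are given as a subset [A] of an ambient type together with an
   operation; the behaviour of the operation outside [A] is irrelevant. *)
Section Groups.
Context {T : Type}.
Implicit Types (A : set T) (op : T -> T -> T).

Definition is_identity A op (e : T) : Prop :=
  A e /\ (forall x, A x -> op e x = x /\ op x e = x).

Definition is_group A op : Prop :=
  [/\ forall x y, A x -> A y -> A (op x y),
      forall x y z, A x -> A y -> A z -> op (op x y) z = op x (op y z)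
    & exists e, is_identity A op e /\
        forall x, A x -> exists y, [/\ A y, op y x = e & op x y = e]].

Definition is_abelian_group A op : Prop :=
  is_group A op /\ forall x y, A x -> A y -> op x y = op y x.

End Groups.

Definition is_group_hom {T U : Type} (A : set T) (opA : T -> T -> T)
    (B : set U) (opB : U -> U -> U) (f : T -> U) : Prop :=
  (forall x, A x -> B (f x)) /\
  (forall x y, A x -> A y -> f (opA x y) = opB (f x) (f y)).

(* 1 -> K -> E -> D -> 1 with maps i : K -> E and p : E -> D. *)
Record is_extension {TK TE TD : Type}
    (K : set TK) (opK : TK -> TK -> TK)
    (E : set TE) (opE : TE -> TE -> TE)
    (D : set TD) (opD : TD -> TD -> TD)
    (i : TK -> TE) (p : TE -> TD) : Prop := IsExtension {
  ext_kernel_group : is_abelian_group K opK;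
  ext_total_group : is_group E opE;
  ext_quotient_group : is_group D opD;
  ext_inj_hom : is_group_hom K opK E opE i;
  ext_proj_hom : is_group_hom E opE D opD p;
  ext_inj : set_inj K i;
  ext_exact : i @` K = [set x | E x /\ is_identity D opD (p x)];
  ext_surj : p @` E = D
}.

Section Smooth.
Context {R : realType} {N : nat}.
Local Notation V := 'cV[R]_N.

Definition partial (k : 'I_N) (f : V -> R) : V -> R :=
  fun x => 'D_(delta_mx k 0) f x.

Definition iter_partial (s : seq 'I_N) (f : V -> R) : V -> R :=
  foldr partial f s.

(* [f] is C^oo on a neighborhood of [p]: there, every iterated partial
   derivative is again (Frechet) differentiable. *)
Definition smooth_near (p : V) (f : V -> R) : Prop :=
  \forall q \near p, forall s, differentiable (iter_partial s f) q.

End Smooth.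

Section Torus.
Variables (R : realType) (N : nat).
Local Notation V := 'cV[R]_N.

Definition lattice : pred V := fun v => [forall i, v i 0 \is a Num.int].

Lemma lattice_zmod_closed : zmod_closed lattice.
Proof.
split; first by apply/forallP => i; rewrite mxE rpred0.
move=> u v /forallP hu /forallP hv; apply/forallP => i.
by rewrite !mxE rpredB.
Qed.

HB.instance Definition _ := GRing.isZmodClosed.Build V lattice
  lattice_zmod_closed.

(* The quotient group R^N / Z^N. *)
Definition torus : Type := Quotient.quot (GRing.ZmodClosed.clone V lattice _).

HB.instance Definition _ := EqQuotient.on torus.

Definition to_torus : V -> torus := \pi_torus.

(* All tangent spaces of the torus are identified with [V], and functions on
   the torus with periodic functions on [V], through [to_torus]. *)
Definition smooth_fun (a : torus -> R) : Prop :=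
  forall p : V, smooth_near p (a \o to_torus).

Definition local_lift (F : torus -> torus) (p : V) (f : V -> V) : Prop :=
  (forall i, smooth_near p (fun y => f y i 0)) /\
  \forall y \near p, to_torus (f y) = F (to_torus y).

Definition smooth_map (F : torus -> torus) : Prop :=
  forall p : V, exists f : V -> V, local_lift F p f.

Definition Diff : set (torus -> torus) :=
  [set F | smooth_map F /\
     exists G, [/\ smooth_map G, cancel F G & cancel G F]].

(* The matrix of partial derivatives, at a point over [x], of some smooth local
   lift of [F]; it depends neither on the lift nor on the point over [x]
   (see [torus_jacobianE]). *)
Definition torus_jacobian (F : torus -> torus) (x : torus) : 'M[R]_N :=
  let f := xget (fun=> 0) (local_lift F (repr x)) in
  \matrix_(i, k) partial k (fun y => f y i 0) (repr x).

Lemma to_torusP (p q : V) : to_torus p = to_torus q -> forall i, (p - q) i 0 \is a Num.int.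
Proof.
move=> e; have : p - q \in lattice.
  by rewrite Quotient.idealrBE; apply/eqP; exact: e.
by move=> /forallP.
Qed.

Lemma derive_near_shift (f g : V -> R) (c : V) (b : R) (p v : V) :
  (\forall y \near p, f y = g (y - c) + b) ->
  'D_v f p = 'D_v g (p - c).
Proof.
move=> fg; rewrite (near_eq_derive _ fg) /derive.
suff -> : (fun h : R => h^-1 *: (((fun y => g (y - c) + b) \o shift p) (h *: v)
    - (g (p - c) + b))) =
  (fun h : R => h^-1 *: ((g \o shift (p - c)) (h *: v) - g (p - c))) by [].
apply/funext => h /=.
by rewrite addrA [X in _ *: (_ + X)]opprD addrACA subrr addr0.
Qed.

Lemma torus_jacobianE (F : torus -> torus) (p : V) (f : V -> V) :
  smooth_map F -> local_lift F p f ->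
  torus_jacobian F (to_torus p) = \matrix_(i, k) partial k (fun y => f y i 0) p.
Proof.
move=> smF [smf fF]; rewrite /torus_jacobian.
set q := repr _; have pqE : to_torus p = to_torus q by rewrite /to_torus /q reprK.
set c := p - q; have qE : q = p - c by rewrite /c opprB addrC subrK.
set g := xget _ _; have [smg gF] : local_lift F q g.
  by have [g0 hg0] := smF q; exact: xgetI hg0.
have cC : {for p, continuous (fun y : V => y - c)}.
  by apply: (@continuousB _ _ _ idfun (cst c));
    [exact: cvg_id|exact: cst_continuous].
have gFp : \forall y \near p, to_torus (g (y - c)) = F (to_torus y).
  have : \forall y \near p, to_torus (g (y - c)) = F (to_torus (y - c)).
    have : \forall z \near (p - c), to_torus (g z) = F (to_torus z) by rewrite -qE.
    exact: cC.
  apply: filterS => y ->; congr F; apply/eqP.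
  rewrite /to_torus -Quotient.idealrBE addrAC subrr add0r rpredN.
  by rewrite Quotient.idealrBE; apply/eqP.
apply/matrixP => i k; rewrite !mxE /partial.
pose h y := f y i 0 - g (y - c) i 0.
have hZ : \forall y \near p, h y \is a Num.int.
  apply: filterS2 fF gFp => y e1 e2.
  by have := to_torusP (etrans e1 (esym e2)) i; rewrite !mxE.
have gC : {for p - c, continuous (fun y => g y i 0)}.
  rewrite -qE.
  exact: (differentiable_continuous (nbhs_singleton (smg i) [::])).
have hC : {for p, continuous h}.
  apply: (@continuousB _ _ _ (fun y => f y i 0) (fun y => g (y - c) i 0)).
    exact: (differentiable_continuous (nbhs_singleton (smf i) [::])).
  exact: (continuous_comp cC gC).
rewrite {1}qE; apply/esym/(@derive_near_shift _ _ _ (h p)).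
have h1 : \forall y \near p, `|h p - h y| < 1
  by move: hC => /cvgrPdist_lt; apply; exact: ltr01.
have hpZ := nbhs_singleton hZ.
apply: filterS2 hZ h1 => y hyZ hy1.
have hpy : h p = h y.
  apply/eqP; rewrite -subr_eq0; apply/negPn/negP => hn0.
  have : h p - h y \is a Num.int by rewrite rpredB.
  by move/norm_intr_ge1 => /(_ hn0); rewrite leNgt hy1.
by rewrite hpy /h addrC subrK.
Qed.

(* Forms are evaluated at a point and on tangent vectors there; addition of
   forms is pointwise. *)
Definition form1 := torus -> V -> R.
Definition form2 := torus -> V -> V -> R.

(* Smoothness is that of the coefficients, i.e. of the values of the form on
   constant vector fields. *)
Definition Omega2 : set form2 :=
  [set w | [/\ forall x v, scalar (w x ^~ v),
               forall x u, scalar (w x u),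
               forall x u, w x u u = 0
             & forall u v, smooth_fun (fun x => w x u v)]].

(* (G^* w)_x (u, v) = w_{G x} (dG_x u, dG_x v). *)
Definition pullback (G : torus -> torus) (w : form2) : form2 :=
  fun x u v => w (G x) (torus_jacobian G x *m u) (torus_jacobian G x *m v).

Definition diff1 (a : torus -> R) : form1 :=
  fun x v => 'D_v (a \o to_torus) (repr x).

(* Normalized so that (dx_i /\ dx_j)(u, v) = u_i v_j - u_j v_i. *)
Definition wedge1 (a b : form1) : form2 :=
  fun x u v => a x u * b x v - a x v * b x u.

Definition dmx (f : torus -> 'M[R]_N) : 'M[form1]_N :=
  \matrix_(i, j) diff1 (fun x => f x i j).

Definition lmul_form1 (f : torus -> 'M[R]_N) (A : 'M[form1]_N) : 'M[form1]_N :=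
  \matrix_(i, j) ((fun x v => \sum_k f x i k * A k j x v) : form1).

Definition rmul_form1 (A : 'M[form1]_N) (f : torus -> 'M[R]_N) : 'M[form1]_N :=
  \matrix_(i, j) ((fun x v => \sum_k A i k x v * f x k j) : form1).

Definition wedgemx (A B : 'M[form1]_N) : 'M[form2]_N :=
  \matrix_(i, j) \sum_k wedge1 (A i k) (B k j).

Definition mxinv (f : torus -> 'M[R]_N) : torus -> 'M[R]_N :=
  fun x => invmx (f x).

(* Tr (f^-1 df /\ dg g^-1) for f = F^J(G) and g = G^J. *)
Definition cocycle (F G : torus -> torus) : form2 :=
  let f := torus_jacobian F \o G in
  let g := torus_jacobian G in
  \tr (wedgemx (lmul_form1 (mxinv f) (dmx f)) (rmul_form1 (dmx g) (mxinv g))).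

Definition ext_mul (p q : (torus -> torus) * form2) :
    (torus -> torus) * form2 :=
  (p.1 \o q.1, pullback q.1 p.2 + q.2 + cocycle p.1 q.1).

End Torus.

Arguments Diff {R N}.
Arguments Omega2 {R N}.
Arguments ext_mul {R N}.

(* Main.v *)
From HB Require Import structures.
Require Import Defs.
From mathcomp Require Import all_boot all_order all_algebra.
From mathcomp Require Import all_classical all_reals all_analysis.

Import Order.TTheory GRing.Theory Num.Theory.
Import numFieldNormedType.Exports.

Local Open Scope classical_set_scope.
Local Open Scope ring_scope.

(** The projection is a homomorphism, so everything rests on the 2-cocycle
    identity c(F,G)(H) + c(FG,H) = c(G,H) + c(F,GH) for
    c(F,G) = Tr(f^-1 df /\ dg g^-1).  Put A = F^J(GH), B = G^J(H) and C = H^J.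
    The chain rule gives (FG)^J(H) = AB and (GH)^J = BC, and pull-back commutes
    with d, so the identity only involves A, B, C and their differentials; it
    then follows from the Leibniz rule and the cyclicity of the trace.
    Smoothness of the inverse jacobians needs no division: they are jacobians
    of the inverse diffeomorphism. *)

(** * Differentiability depends only on the germ of a map *)

Section NearDifferentiable.
Context {R : numFieldType} {V W : normedModType R}.

(** Near [x] all of [h] can serve as the little-o remainder, so uniqueness of the differential
    forces ['d h x = 0], which is continuous. *)
Lemma differentiable_near0 (h : V -> W) (x : V) :
  (\forall y \near x, h y = 0) -> differentiable h x.
Proof.
move=> h0; have hx : h x = 0 := nbhs_singleton h0.
have h_o : h \o shift x = cst (h x) + \0 +o_ 0 id.
  apply/eqaddoE; rewrite hx addr0 funeqE => y /=.
  rewrite -[LHS]add0r; congr (_ + _).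
  rewrite littleoE // => _ /posnumP[e].
  have : \forall y \near (0 : V), h (y + x) = 0.
    by rewrite (near_shift x); near=> z => /=; rewrite sub0r addrNK; near: z.
  by apply: filterS => z /= ->; rewrite normr0 mulr_ge0.
have d0 : 'd h x = \0 :> (V -> W).
  by apply: diff_unique h_o; exact: cst_continuous.
by apply/diff_locallyP; rewrite d0; split=> //; exact: cst_continuous.
Unshelve. all: by end_near. Qed.

Lemma near_eq_differentiable (f g : V -> W) (x : V) :
  (\forall y \near x, f y = g y) -> differentiable f x -> differentiable g x.
Proof.
move=> fg df; have -> : g = f + (g - f) by rewrite addrC subrK.
apply: differentiableD => //; apply: differentiable_near0.
by apply: filterS fg => y fgy; rewrite !fctE fgy subrr.
Qed.

End NearDifferentiable.

(** * Calculus of finitely and infinitely differentiable functions on R^N *)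

Section Calculus.
Context {R : realType} {N : nat}.
Local Notation V := 'cV[R]_N.
Implicit Types (f g : V -> R) (h : V -> V) (U W : set V) (p q x v : V).

Lemma derive_partial f x v :
  differentiable f x -> 'D_v f x = \sum_k v k 0 * partial k f x.
Proof.
move=> df; rewrite deriveE // {1}[v]matrix_sum_delta linear_sum.
apply: eq_bigr => k _; rewrite big_ord1 linearZ /= /partial deriveE //.
Qed.

Lemma differentiable_cV h x :
  (forall i, differentiable (fun y => h y i 0) x) -> differentiable h x.
Proof.
move=> dh; have -> : h = \sum_(i < N) (fun y => h y i 0 *: delta_mx i 0).
  apply/funext => y; rewrite fct_sumE {1}[h y]matrix_sum_delta.
  by apply: eq_bigr => i _; rewrite big_ord1.
by apply: differentiable_sum => i; exact: differentiableZl.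
Qed.

(** The chain rule in coordinates: the source of closure under composition, of the product rule for
    jacobians, and of the naturality of [diff1]. *)
Lemma derive_comp f h x v :
  (forall i, differentiable (fun y => h y i 0) x) -> differentiable f (h x) ->
  'D_v (f \o h) x = \sum_i 'D_v (fun y => h y i 0) x * partial i f (h x).
Proof.
move=> /differentiable_cV dh df.
rewrite deriveE; last exact: differentiable_comp.
rewrite diff_comp //= -deriveE // derive_partial //; apply: eq_bigr => i _.
congr (_ * _); rewrite -deriveE // derive_mx ?mxE //.
exact: diff_derivable.
Qed.

(* Recursive in the order, so that the product and chain rules give closure of
   each [Cn n U] by induction on [n]. *)
Fixpoint Cn n U f : Prop :=
  (forall q, U q -> differentiable f q) /\
  if n is m.+1 then forall k, Cn m U (partial k f) else True.

Lemma Cn_diff n U f q : Cn n U f -> U q -> differentiable f q.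
Proof. by case: n => [|n] [df _]; exact: df. Qed.

Lemma Cn_partial n U f k : Cn n.+1 U f -> Cn n U (partial k f).
Proof. by move=> [_]; exact. Qed.

Lemma CnS n U f : Cn n.+1 U f -> Cn n U f.
Proof.
elim: n f => [|n IHn] f [df df']; split=> // k.
by apply: IHn; exact: df'.
Qed.

Lemma Cn_sub n U W f : U `<=` W -> Cn n W f -> Cn n U f.
Proof.
move=> UW; elim: n f => [|n IHn] f [df df']; split=> //.
- by move=> q /UW; exact: df.
- by move=> q /UW; exact: df.
- by move=> k; apply: IHn; exact: df'.
Qed.

(** Openness of [U] turns equality on [U] into equality near each of its points, so the partial
    derivatives agree on [U] too. Leibniz and chain formulas, known only on [U], can thus replace a
    derivative. *)
Lemma Cn_eq n U f g :
  open U -> (forall q, U q -> f q = g q) -> Cn n U f -> Cn n U g.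
Proof.
move=> oU; elim: n f g => [|n IHn] f g fg [df df'].
  split=> // q Uq; apply: near_eq_differentiable (df q Uq).
  by apply: filterS (open_nbhs_nbhs (conj oU Uq)).
have nfg q : U q -> \forall y \near q, f y = g y.
  by move=> Uq; apply: filterS (open_nbhs_nbhs (conj oU Uq)).
split=> [q Uq|k]; first exact: near_eq_differentiable (nfg q Uq) (df q Uq).
apply: IHn (df' k) => q Uq.
exact: near_eq_derive (nfg q Uq).
Qed.

Lemma Cn_cst n U (c : R) : Cn n U (cst c).
Proof.
elim: n c => [|n IHn] c; split=> //.
move=> k; have -> : partial k (cst c) = cst 0; last exact: IHn.
by apply/funext => x; rewrite /partial derive_cst.
Qed.

Lemma CnD n U f g : open U -> Cn n U f -> Cn n U g -> Cn n U (f + g).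
Proof.
move=> oU; elim: n f g => [|n IHn] f g [df df'] [dg dg'].
  by split=> // q Uq; apply: differentiableD; [exact: df|exact: dg].
split=> [q Uq|k]; first by apply: differentiableD; [exact: df|exact: dg].
apply: (Cn_eq _ _ (partial k f + partial k g)) => //; last first.
  by apply: IHn; [exact: df'|exact: dg'].
move=> q Uq; rewrite /partial deriveD //; apply: diff_derivable.
- exact: df.
- exact: dg.
Qed.

Lemma CnM n U f g : open U -> Cn n U f -> Cn n U g -> Cn n U (f * g).
Proof.
move=> oU; elim: n f g => [|n IHn] f g Cf Cg.
  have [[df _] [dg _]] := (Cf, Cg).
  by split=> // q Uq; apply: differentiableM; [exact: df|exact: dg].
have [[df df'] [dg dg']] := (Cf, Cg).
split=> [q Uq|k]; first by apply: differentiableM; [exact: df|exact: dg].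
apply: (Cn_eq _ _ (f * partial k g + g * partial k f)) => //.
  move=> q Uq; rewrite /partial deriveM //; apply: diff_derivable.
  - exact: df.
  - exact: dg.
(* The undifferentiated factors have one order to spare, which [CnS] gives up to meet the induction
   hypothesis. *)
by apply: CnD => //; apply: IHn; by [exact: CnS|exact: dg'|exact: df'].
Qed.

Lemma Cn_sum n U (I : Type) (r : seq I) (F : I -> V -> R) :
  open U -> (forall i, Cn n U (F i)) -> Cn n U (\sum_(i <- r) F i).
Proof.
move=> oU CF; elim/big_ind: _ => //; last by move=> f g; exact: CnD.
exact: Cn_cst.
Qed.

Lemma Cn_comp n U W f h : open U -> (forall q, U q -> W (h q)) ->
  (forall i, Cn n U (fun y => h y i 0)) -> Cn n W f -> Cn n U (f \o h).
Proof.
move=> oU hUW; elim: n f => [|n IHn] f Ch [df df'].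
  split=> // q Uq; apply: differentiable_comp; last exact/df/hUW.
  by apply: differentiable_cV => i; exact: Cn_diff (Ch i) Uq.
split=> [q Uq|k].
  apply: differentiable_comp; last exact/df/hUW.
  by apply: differentiable_cV => i; exact: Cn_diff (Ch i) Uq.
(* The induction is on the order with [f] general: the chain rule leaves [partial i f \o h], a
   composite of order one less with the same [h]. *)
apply: (Cn_eq _ _
  (\sum_i (partial k (fun y => h y i 0) * (partial i f \o h)))) => //.
  move=> q Uq; rewrite fct_sumE /partial derive_comp //; last exact/df/hUW.
  by move=> i; exact: Cn_diff (Ch i) Uq.
apply: Cn_sum => // i; apply: CnM => //; first exact: Cn_partial.
by apply: IHn => [j|]; [exact: CnS|exact: df'].
Qed.

(** [Cn] peels off the derivative that is taken first, which [foldr] reads from the end of the list;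
    hence [rcons] and the induction on the last element. *)
Lemma CnP U f : (forall n, Cn n U f) <->
  forall s q, U q -> differentiable (iter_partial s f) q.
Proof.
have iterS s k (a : V -> R) :
    iter_partial (rcons s k) a = iter_partial s (partial k a).
  by rewrite /iter_partial foldr_rcons.
split=> [Cf s|df n].
  elim/last_ind: s f Cf => [|s k IHs] f Cf q Uq; first exact: Cn_diff (Cf 0%N) Uq.
  rewrite iterS; apply: IHs Uq => n.
  exact: Cn_partial.
elim: n f df => [|n IHn] f df; split=> //; try exact: (df [::]).
by move=> k; apply: IHn => s q Uq; rewrite -iterS; exact: df.
Qed.

(** * Smoothness near a point *)

(** One open neighborhood serves all orders at once, so the closure properties of [Cn] carry over to
    [smooth_near]. *)
Lemma smooth_nearP p f :
  smooth_near p f <-> exists2 U, open_nbhs p U & forall n, Cn n U f.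
Proof.
rewrite /smooth_near; split=> [|[U pU /CnP Cf]].
  rewrite /prop_near1 nbhsE => -[U pU sU].
  by exists U => //; apply/CnP => s q Uq; exact: sU.
by apply: filterS (open_nbhs_nbhs pU) => q Uq s; exact: Cf.
Qed.

Lemma smooth_near_eq p f g :
  (\forall y \near p, f y = g y) -> smooth_near p f -> smooth_near p g.
Proof.
rewrite {1}/prop_near1 nbhsE => -[W pW fg] /smooth_nearP[U pU Cf].
apply/smooth_nearP; exists (U `&` W); first exact: open_nbhsI.
move=> n; apply: (Cn_eq _ _ f) => [|q [_ /fg //]|].
  by apply: openI; [case: pU|case: pW].
by apply: Cn_sub (Cf n) => q [].
Qed.

Lemma smooth_near_cst p (c : R) : smooth_near p (cst c).
Proof.
apply/smooth_nearP; exists setT; last by move=> n; exact: Cn_cst.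
by split=> //; exact: openT.
Qed.

Lemma smooth_nearD p f g :
  smooth_near p f -> smooth_near p g -> smooth_near p (f + g).
Proof.
move=> /smooth_nearP[U pU Cf] /smooth_nearP[W pW Cg].
have oUW : open (U `&` W) by apply: openI; [case: pU|case: pW].
apply/smooth_nearP; exists (U `&` W); first exact: open_nbhsI.
by move=> n; apply: CnD => //;
  [apply: Cn_sub (Cf n)|apply: Cn_sub (Cg n)] => q [].
Qed.

Lemma smooth_nearM p f g :
  smooth_near p f -> smooth_near p g -> smooth_near p (f * g).
Proof.
move=> /smooth_nearP[U pU Cf] /smooth_nearP[W pW Cg].
have oUW : open (U `&` W) by apply: openI; [case: pU|case: pW].
apply/smooth_nearP; exists (U `&` W); first exact: open_nbhsI.
by move=> n; apply: CnM => //;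
  [apply: Cn_sub (Cf n)|apply: Cn_sub (Cg n)] => q [].
Qed.

Lemma smooth_near_partial p k f : smooth_near p f -> smooth_near p (partial k f).
Proof.
move=> /smooth_nearP[U pU Cf]; apply/smooth_nearP; exists U => // n.
exact: Cn_partial.
Qed.

Lemma smooth_near_differentiable p f : smooth_near p f -> differentiable f p.
Proof. by move=> sf; exact: nbhs_singleton sf [::]. Qed.

Lemma near_smooth_near p f :
  smooth_near p f -> \forall q \near p, smooth_near q f.
Proof. exact: near_join. Qed.

Lemma smooth_near_coord p i : smooth_near p (fun y : V => y i 0).
Proof.
apply/smooth_nearP; exists setT; first by split=> //; exact: openT.
case=> [|n]; split=> //; try by move=> q _; exact: differentiable_coord.
move=> k; have -> : partial k (fun y : V => y i 0) =
    cst ((delta_mx k 0 : V) i 0); last exact: Cn_cst.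
apply/funext => x; rewrite /partial.
(* The derivatives of the coordinates are the entries of the derivative of the identity. *)
have := @derive_mx R V N 1 id x (delta_mx k 0) (@derivable_id _ _ _ _).
by rewrite derive_id => /(congr1 (fun A : V => A i 0)); rewrite [in RHS]mxE => ->.
Qed.

Lemma smooth_cV_continuous p h :
  (forall i, smooth_near p (fun y => h y i 0)) -> {for p, continuous h}.
Proof.
move=> sh; apply: differentiable_continuous; apply: differentiable_cV => i.
exact: smooth_near_differentiable.
Qed.

Lemma smooth_near_comp p f h : (forall i, smooth_near p (fun y => h y i 0)) ->
  smooth_near (h p) f -> smooth_near p (f \o h).
Proof.
move=> sh /smooth_nearP[W hpW Cf].
(* A common neighborhood exists because there are finitely many coordinates [i]; the quantifier over
   [s] already lies inside [smooth_near]. *)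
have : \forall q \near p, [/\ forall i s,
    differentiable (iter_partial s (fun y => h y i 0)) q & W (h q)].
  have hW : \forall q \near p, W (h q).
    by apply: (smooth_cV_continuous _ _ sh); exact: open_nbhs_nbhs.
  have dh : \forall q \near p, forall i s,
      differentiable (iter_partial s (fun y => h y i 0)) q.
    exact: filter_forall sh.
  by apply: filterS2 hW dh.
rewrite {1}/prop_near1 nbhsE => -[U pU UhW].
have oU : open U by case: pU.
apply/smooth_nearP; exists U => // n.
apply: (Cn_comp _ _ W) => // [q /UhW[]//|i].
by apply: (CnP U _).2 => s q /UhW[].
Qed.

End Calculus.

(** * Smooth functions, smooth maps and jacobians on the torus *)

Section Torus.
Context {R : realType} {N : nat}.
Local Notation V := 'cV[R]_N.
Local Notation T := (torus R N).
Implicit Types (a b : T -> R) (F G : T -> T) (p q u v : V) (x : T).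

Lemma to_torus_repr x : to_torus (repr x) = x.
Proof. exact: reprK. Qed.

Lemma smooth_fun_cst (c : R) : smooth_fun (fun=> c : R) (N := N).
Proof. by move=> p; exact: smooth_near_cst. Qed.

Lemma smooth_funD a b :
  smooth_fun a -> smooth_fun b -> smooth_fun (fun x => a x + b x).
Proof. by move=> sa sb p; exact: smooth_nearD. Qed.

Lemma smooth_funM a b :
  smooth_fun a -> smooth_fun b -> smooth_fun (fun x => a x * b x).
Proof. by move=> sa sb p; exact: smooth_nearM. Qed.

Lemma smooth_funN a : smooth_fun a -> smooth_fun (fun x => - a x).
Proof.
move=> sa; have -> : (fun x => - a x) = (fun x => -1 * a x).
  by apply/funext => x; rewrite mulN1r.
by apply: smooth_funM => //; exact: smooth_fun_cst.
Qed.

Lemma smooth_fun_sum (I : Type) (r : seq I) (A : I -> T -> R) :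
  (forall i, smooth_fun (A i)) -> smooth_fun (fun x => \sum_(i <- r) A i x).
Proof.
move=> sA; elim: r => [|i r IHr].
  by under eq_fun do rewrite big_nil; exact: smooth_fun_cst.
by under eq_fun do rewrite big_cons; exact: smooth_funD.
Qed.

Lemma local_lift_at F p f : local_lift F p f -> to_torus (f p) = F (to_torus p).
Proof. by move=> [_ /nbhs_singleton]. Qed.

(** This lets a single lift compute the jacobian at all nearby points, not only at [p]. *)
Lemma near_local_lift F p f :
  local_lift F p f -> \forall q \near p, local_lift F q f.
Proof.
move=> [sf fF]; have sf' : \forall q \near p, forall i,
    smooth_near q (fun y => f y i 0).
  exact: filter_forall (fun i => near_smooth_near _ _ (sf i)).
exact: filterS2 sf' (near_join fF).
Qed.

Lemma local_lift_comp F G p f g :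
  local_lift G p g -> local_lift F (g p) f -> local_lift (F \o G) p (f \o g).
Proof.
move=> [sg gG] [sf fF]; split=> [i|].
  exact: (smooth_near_comp p (fun y => f y i 0) g sg (sf i)).
have gfF : \forall y \near p, to_torus (f (g y)) = F (to_torus (g y)).
  exact: (smooth_cV_continuous _ _ sg _ fF).
by apply: filterS2 gG gfF => y /= <- ->.
Qed.

Lemma local_lift_id p : local_lift id p id.
Proof.
by split=> [i|]; [exact: smooth_near_coord|exact: (@filterE _ (nbhs p))]. Qed.

Lemma smooth_map_id : smooth_map (id : T -> T).
Proof. by move=> p; exists id; exact: local_lift_id. Qed.

Lemma smooth_map_comp F G : smooth_map F -> smooth_map G -> smooth_map (F \o G).
Proof.
move=> sF sG p; have [g gG] := sG p; have [f fF] := sF (g p).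
by exists (f \o g); exact: local_lift_comp.
Qed.

Lemma smooth_fun_comp a F :
  smooth_fun a -> smooth_map F -> smooth_fun (fun x => a (F x)).
Proof.
move=> sa sF p; have [f [sf fF]] := sF p.
apply: (smooth_near_eq p ((a \o @to_torus R N) \o f)).
  by apply: filterS fF => y /= ->.
exact: smooth_near_comp.
Qed.

(** The definition picks an unrelated lift at every point; since the jacobian does not depend on it,
    near [p] it is given by the partial derivatives of one fixed smooth lift. *)
Lemma smooth_torus_jacobian F i k :
  smooth_map F -> smooth_fun (fun x => torus_jacobian F x i k).
Proof.
move=> sF p; have [f fF] := sF p.
apply: (smooth_near_eq p (partial k (fun y => f y i 0))).
  apply: filterS (near_local_lift _ _ _ fF) => y fy.
  by rewrite /= (torus_jacobianE sF fy) mxE.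
by apply: smooth_near_partial; case: fF.
Qed.

Lemma torus_jacobian_comp F G x : smooth_map F -> smooth_map G ->
  torus_jacobian (F \o G) x = torus_jacobian F (G x) *m torus_jacobian G x.
Proof.
move=> sF sG; rewrite -[x]to_torus_repr; set p := repr x.
(* The lift of [F] is taken at [g p], which need not be the chosen representative of [G x];
   [torus_jacobianE] holds over any point. *)
have [g gG] := sG p; have [f fF] := sF (g p).
rewrite (torus_jacobianE (smooth_map_comp _ _ sF sG)
  (local_lift_comp _ _ _ _ _ gG fF)).
rewrite (torus_jacobianE sG gG) -(local_lift_at _ _ _ gG) (torus_jacobianE sF fF).
apply/matrixP => i k; rewrite !mxE.
rewrite /partial (derive_comp (fun y => f y i 0)).
- by apply: eq_bigr => j _; rewrite !mxE mulrC.
- by move=> j; apply: smooth_near_differentiable; case: gG.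
- by apply: smooth_near_differentiable; case: fF.
Qed.

Lemma torus_jacobian_id x : torus_jacobian id x = 1%:M.
Proof.
rewrite -[x]to_torus_repr.
rewrite (torus_jacobianE smooth_map_id (local_lift_id _)).
apply/matrixP => i k; rewrite !mxE /partial.
have := @derive_mx R V N 1 id (repr x) (delta_mx k 0) (@derivable_id _ _ _ _).
rewrite derive_id => /(congr1 (fun A : V => A i 0)); rewrite [in RHS]mxE => <-.
by rewrite mxE eqxx andbT.
Qed.

(** * Differentials of functions on the torus *)

(** [diff1] differentiates at a chosen representative; periodicity of [a \o to_torus] makes the
    choice irrelevant. *)
Lemma diff1E a p v : diff1 a (to_torus p) v = 'D_v (a \o @to_torus R N) p.
Proof.
rewrite /diff1; set q := repr _.
have qp : to_torus q = to_torus p by exact: to_torus_repr.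
rewrite -[p in RHS](subKr q).
(* The shift is the lattice vector [q - p], and the values change by [0]. *)
apply: (@derive_near_shift _ _ _ _ _ 0); apply: (@filterE _ (nbhs q)) => y /=.
rewrite addr0; congr a; apply/eqP.
rewrite /to_torus -Quotient.idealrBE subKr.
by rewrite Quotient.idealrBE; apply/eqP.
Qed.

Lemma smooth_fun_differentiable a p :
  smooth_fun a -> differentiable (a \o @to_torus R N) p.
Proof. by move=> sa; exact: smooth_near_differentiable. Qed.

Lemma diff1_linear a x : smooth_fun a -> scalar (diff1 a x).
Proof.
move=> sa c u v; have da := smooth_fun_differentiable a (repr x) sa.
by rewrite /diff1 !deriveE // linearP.
Qed.

Lemma smooth_diff1 a v : smooth_fun a -> smooth_fun (fun x => diff1 a x v).
Proof.
move=> sa p; apply: (smooth_near_eq p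
  (\sum_k (cst (v k 0) * partial k (a \o @to_torus R N)))).
  apply: (@filterE _ (nbhs p)) => y; rewrite /= diff1E derive_partial ?fct_sumE //.
  exact: smooth_fun_differentiable.
elim/big_ind: _ => [|f g|k _]; [exact: smooth_near_cst|exact: smooth_nearD|].
by apply: smooth_nearM; [exact: smooth_near_cst|exact: smooth_near_partial].
Qed.

Lemma diff1_cst (c : R) x v : diff1 (fun=> c) x v = 0.
Proof. exact: derive_cst. Qed.

Lemma diff1D a b x v : smooth_fun a -> smooth_fun b ->
  diff1 (fun x => a x + b x) x v = diff1 a x v + diff1 b x v.
Proof.
move=> sa sb; rewrite /diff1.
by apply: deriveD; apply: diff_derivable; exact: smooth_fun_differentiable.
Qed.

Lemma diff1M a b x v : smooth_fun a -> smooth_fun b ->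
  diff1 (fun x => a x * b x) x v = diff1 a x v * b x + a x * diff1 b x v.
Proof.
move=> sa sb; rewrite /diff1.
have -> : (fun x => a x * b x) \o @to_torus R N =
  (a \o @to_torus R N) * (b \o @to_torus R N) by [].
rewrite deriveM; try by apply: diff_derivable; exact: smooth_fun_differentiable.
by rewrite /= !to_torus_repr addrC [_ *: _]mulrC.
Qed.

Lemma diff1_sum (I : Type) (r : seq I) (A : I -> T -> R) x v :
  (forall i, smooth_fun (A i)) ->
  diff1 (fun x => \sum_(i <- r) A i x) x v = \sum_(i <- r) diff1 (A i) x v.
Proof.
move=> sA; elim: r => [|i r IHr].
  by under eq_fun do rewrite big_nil; rewrite big_nil diff1_cst.
under eq_fun do rewrite big_cons.
by rewrite big_cons diff1D ?IHr //; exact: smooth_fun_sum.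
Qed.

(** Pull-back commutes with d on functions, by the chain rule along a local lift of [G]. *)
Lemma diff1_comp a G x v : smooth_fun a -> smooth_map G ->
  diff1 (fun x => a (G x)) x v = diff1 a (G x) (torus_jacobian G x *m v).
Proof.
move=> sa sG; rewrite -[x]to_torus_repr; set p := repr x.
have [g gG] := sG p; rewrite (torus_jacobianE sG gG).
rewrite -(local_lift_at _ _ _ gG) !diff1E.
have -> : 'D_v ((fun x => a (G x)) \o @to_torus R N) p =
    'D_v ((a \o @to_torus R N) \o g) p.
  by apply: near_eq_derive; case: gG => _; apply: filterS => y /= ->.
have dg i : differentiable (fun y => g y i 0) p.
  by apply: smooth_near_differentiable; case: gG.
have da := smooth_fun_differentiable a (g p) sa.
rewrite derive_comp // derive_partial //; apply: eq_bigr => i _.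
congr (_ * _); rewrite derive_partial // mxE; apply: eq_bigr => k _.
by rewrite mxE mulrC.
Qed.

(** * Smooth matrix-valued functions and their derivatives *)

Definition smooth_mx (A : T -> 'M[R]_N) : Prop :=
  forall i j, smooth_fun (fun x => A x i j).

(** This is dA evaluated on [v]: a real matrix in place of a matrix of 1-forms, so that ordinary
    matrix algebra applies. *)
Definition derive_torus_mx (A : T -> 'M[R]_N) (x : T) (v : V) : 'M[R]_N :=
  \matrix_(i, j) diff1 (fun x => A x i j) x v.

Implicit Types A B : T -> 'M[R]_N.

Lemma smooth_mxM A B :
  smooth_mx A -> smooth_mx B -> smooth_mx (fun x => A x *m B x).
Proof.
move=> sA sB i j; under eq_fun do rewrite mxE.
by apply: smooth_fun_sum => k; exact: smooth_funM.
Qed.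

Lemma smooth_mxtrace A : smooth_mx A -> smooth_fun (fun x => \tr (A x)).
Proof. by move=> sA; apply: smooth_fun_sum => k. Qed.

Lemma smooth_mx_comp A G :
  smooth_mx A -> smooth_map G -> smooth_mx (fun x => A (G x)).
Proof. by move=> sA sG i j; exact: (smooth_fun_comp _ _ (sA i j)). Qed.

Lemma smooth_mx_jacobian F : smooth_map F -> smooth_mx (torus_jacobian F).
Proof. by move=> sF i j; exact: smooth_torus_jacobian. Qed.

Lemma smooth_derive_torus_mx A v :
  smooth_mx A -> smooth_mx (fun x => derive_torus_mx A x v).
Proof.
by move=> sA i j; under eq_fun do rewrite mxE; exact: smooth_diff1.
Qed.

Lemma derive_torus_mx_linear A x : smooth_mx A -> linear (derive_torus_mx A x).
Proof.
by move=> sA c u v; apply/matrixP => i j; rewrite !mxE (diff1_linear _ x (sA i j)).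
Qed.

Lemma derive_torus_mx_cst (M : 'M[R]_N) x v : derive_torus_mx (fun=> M) x v = 0.
Proof. by apply/matrixP => i j; rewrite !mxE diff1_cst. Qed.

Lemma derive_torus_mxM A B x v : smooth_mx A -> smooth_mx B ->
  derive_torus_mx (fun x => A x *m B x) x v =
    derive_torus_mx A x v *m B x + A x *m derive_torus_mx B x v.
Proof.
move=> sA sB; apply/matrixP => i j; rewrite !mxE.
under eq_fun do rewrite mxE.
rewrite diff1_sum; last by move=> k; exact: smooth_funM.
rewrite -big_split; apply: eq_bigr => k _.
by rewrite diff1M // !mxE.
Qed.

Lemma derive_torus_mx_comp A G x v : smooth_mx A -> smooth_map G ->
  derive_torus_mx (A \o G) x v =
    derive_torus_mx A (G x) (torus_jacobian G x *m v).
Proof.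
move=> sA sG; apply/matrixP => i j; rewrite !mxE.
by rewrite -(diff1_comp (fun x => A x i j)).
Qed.

(** * Diffeomorphisms and the invertibility of their jacobians *)

Lemma Diff_smooth F : Diff F -> smooth_map F.
Proof. by case. Qed.

Lemma Diff_id : Diff (id : T -> T).
Proof.
by split; [exact: smooth_map_id|exists id; split=> //; exact: smooth_map_id].
Qed.

Lemma Diff_comp F G : Diff F -> Diff G -> Diff (F \o G).
Proof.
move=> [sF [F' [sF' FK F'K]]] [sG [G' [sG' GK G'K]]].
split; first exact: smooth_map_comp.
by exists (G' \o F'); split; [exact: smooth_map_comp|exact: can_comp..].
Qed.

Lemma Diff_inv F : Diff F ->
  exists F', [/\ Diff F', F' \o F = id & F \o F' = id].
Proof.
move=> [sF [F' [sF' FK F'K]]]; exists F'; split.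
- by split=> //; exists F.
- by apply/funext => x /=; rewrite FK.
- by apply/funext => x /=; rewrite F'K.
Qed.

(** Differentiate [F' \o F = id]. A left inverse suffices, since the matrices are square. *)
Lemma Diff_jacobian_inv F : Diff F -> exists2 J : T -> 'M[R]_N,
  smooth_mx J & forall x, J x *m torus_jacobian F x = 1%:M.
Proof.
move=> dF; have [F' [dF' F'F _]] := Diff_inv F dF.
have [sF sF'] := (Diff_smooth _ dF, Diff_smooth _ dF').
exists (fun x => torus_jacobian F' (F x)).
  by apply: smooth_mx_comp => //; exact: smooth_mx_jacobian.
by move=> x; rewrite -torus_jacobian_comp // F'F torus_jacobian_id.
Qed.

Lemma Diff_jacobian_unit F x : Diff F -> torus_jacobian F x \in unitmx.
Proof. by move=> /Diff_jacobian_inv[J _ /(_ x)]/mulmx1_unit[]. Qed.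

Lemma smooth_mx_invjacobian F :
  Diff F -> smooth_mx (fun x => invmx (torus_jacobian F x)).
Proof.
move=> /Diff_jacobian_inv[J sJ JF].
suff -> : (fun x => invmx (torus_jacobian F x)) = J by [].
apply/funext => x; have [_ uF] := mulmx1_unit (JF x).
by rewrite -[J x]mulmx1 -(mulmxV uF) mulmxA JF mul1mx.
Qed.

(** * The trace form behind the cocycle *)

(** The bilinear form Tr(A^-1 dA(u) dB(v) B^-1), before antisymmetrization in [u] and [v]. *)
Definition trace_form A B x u v : R :=
  \tr (invmx (A x) *m derive_torus_mx A x u
       *m (derive_torus_mx B x v *m invmx (B x))).

Lemma form2_sumE (I : Type) (r : seq I) (w : I -> form2 R N) x u v :
  (\sum_(i <- r) w i) x u v = \sum_(i <- r) w i x u v.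
Proof. by elim/big_rec2: _ => [//|i s w' _ <-]. Qed.

Lemma lmul_form1E A x u i j :
  lmul_form1 (mxinv A) (dmx A) i j x u =
    (invmx (A x) *m derive_torus_mx A x u) i j.
Proof. by rewrite !mxE; apply: eq_bigr => k _; rewrite !mxE. Qed.

Lemma rmul_form1E A x u i j :
  rmul_form1 (dmx A) (mxinv A) i j x u =
    (derive_torus_mx A x u *m invmx (A x)) i j.
Proof. by rewrite !mxE; apply: eq_bigr => k _; rewrite !mxE. Qed.

(** The wedge product antisymmetrizes, so identities between cocycles reduce to identities between
    trace forms at fixed [u] and [v]. *)
Lemma cocycleE F G x u v :
  cocycle F G x u v =
    trace_form (torus_jacobian F \o G) (torus_jacobian G) x u v -
    trace_form (torus_jacobian F \o G) (torus_jacobian G) x v u.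
Proof.
rewrite /cocycle /mxtrace form2_sumE /trace_form /mxtrace -sumrB.
apply: eq_bigr => i _; rewrite /wedgemx mxE form2_sumE.
rewrite [X in _ = X - _]mxE [X in _ = _ - X]mxE -sumrB.
by apply: eq_bigr => k _; rewrite /wedge1 !lmul_form1E !rmul_form1E.
Qed.

Lemma trace_form_linear A B x (c : R) u u' v : smooth_mx A ->
  trace_form A B x (c *: u + u') v =
    c * trace_form A B x u v + trace_form A B x u' v.
Proof.
move=> sA; rewrite /trace_form derive_torus_mx_linear //.
by rewrite mulmxDr mulmxDl -scalemxAr -scalemxAl mxtraceD mxtraceZ.
Qed.

Lemma trace_form_linear_r A B x (c : R) u v v' : smooth_mx B ->
  trace_form A B x u (c *: v + v') =
    c * trace_form A B x u v + trace_form A B x u v'.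
Proof.
move=> sB; rewrite /trace_form derive_torus_mx_linear //.
by rewrite mulmxDl mulmxDr -scalemxAl -scalemxAr mxtraceD mxtraceZ.
Qed.

(** Only the derivatives see the vectors, and they transform by the jacobian of [G]; this expresses
    the pull-back of a cocycle by composed jacobians. *)
Lemma trace_form_comp A B G x u v : smooth_mx A -> smooth_mx B -> smooth_map G ->
  trace_form (A \o G) (B \o G) x u v =
    trace_form A B (G x) (torus_jacobian G x *m u) (torus_jacobian G x *m v).
Proof. by move=> sA sB sG; rewrite /trace_form 2?derive_torus_mx_comp. Qed.

Lemma smooth_trace_form A B u v : smooth_mx A -> smooth_mx B ->
  smooth_mx (fun x => invmx (A x)) -> smooth_mx (fun x => invmx (B x)) ->
  smooth_fun (fun x => trace_form A B x u v).
Proof.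
move=> sA sB sA' sB'; apply: smooth_mxtrace; apply: smooth_mxM.
  by apply: smooth_mxM => //; exact: smooth_derive_torus_mx.
by apply: smooth_mxM => //; exact: smooth_derive_torus_mx.
Qed.

Lemma trace_form_cst_l A (M : 'M[R]_N) x u v : trace_form (fun=> M) A x u v = 0.
Proof. by rewrite /trace_form derive_torus_mx_cst mulmx0 mul0mx mxtrace0. Qed.

Lemma trace_form_cst_r A (M : 'M[R]_N) x u v : trace_form A (fun=> M) x u v = 0.
Proof. by rewrite /trace_form derive_torus_mx_cst mul0mx mulmx0 mxtrace0. Qed.

Lemma invmxM (A B : 'M[R]_N) : A \in unitmx -> B \in unitmx ->
  invmx (A *m B) = invmx B *m invmx A.
Proof.
move=> uA uB; have uAB : A *m B \in unitmx by rewrite unitmx_mul uA.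
apply: (can_inj (mulKmx uAB)); rewrite mulmxV //.
by rewrite mulmxA mulmxK // mulmxV.
Qed.

(* By the Leibniz rule and cyclicity of the trace, both sides equal
   Tr(a^-1 a' b' b^-1) + Tr(a^-1 a' b c' (bc)^-1) + Tr(b^-1 b' c' c^-1). *)
Lemma trace_form_cocycle A B C x u v :
  smooth_mx A -> smooth_mx B -> smooth_mx C ->
  A x \in unitmx -> B x \in unitmx -> C x \in unitmx ->
  trace_form A B x u v + trace_form (fun x => A x *m B x) C x u v =
  trace_form B C x u v + trace_form A (fun x => B x *m C x) x u v.
Proof.
move=> sA sB sC uA uB uC; rewrite /trace_form !derive_torus_mxM // !invmxM //.
set a := A x; set b := B x; set c := C x.
set da := derive_torus_mx A x u; set dbu := derive_torus_mx B x u.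
set dbv := derive_torus_mx B x v; set dc := derive_torus_mx C x v.
rewrite !(mulmxDl, mulmxDr) !mxtraceD !mulmxA.
have -> : \tr (invmx b *m invmx a *m da *m b *m dc *m invmx c) =
    \tr (invmx a *m da *m b *m dc *m invmx c *m invmx b).
  by rewrite -!mulmxA mxtrace_mulC !mulmxA.
(* The pairs [invmx a *m a] and [c *m invmx c] cancel; only the order of the three terms remains. *)
by rewrite mulmxKV // (mulmxK uC) addrA addrC.
Qed.

(** * The space of 2-forms and its closure properties *)

Lemma scalar_sum_delta (f : V -> R) v :
  scalar f -> f v = \sum_k v k 0 * f (delta_mx k 0).
Proof.
(* [Omega2] supplies linearity as a bare property; it is bundled here so that [linear_sum] and
   [linearZ] apply. *)
move=> lf; pose fM := GRing.isLinear.Build _ _ _ _ _ lf.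
pose fL : {scalar V} := HB.pack f fM.
rewrite {1}[v]matrix_sum_delta -[f _]/(fL _) linear_sum.
by apply: eq_bigr => k _; rewrite big_ord1 linearZ.
Qed.

Lemma Omega2D (w w' : form2 R N) : Omega2 w -> Omega2 w' -> Omega2 (w + w').
Proof.
move=> [wl wr w0 ws] [wl' wr' w0' ws']; split=> [x v|x u|x u|u v].
- by move=> c u u'; rewrite !fctE wl wl' mulrDr addrACA.
- by move=> c v v'; rewrite !fctE wr wr' mulrDr addrACA.
- by rewrite !fctE w0 w0' addr0.
- exact: smooth_funD.
Qed.

Lemma Omega2N (w : form2 R N) : Omega2 w -> Omega2 (- w).
Proof.
move=> [wl wr w0 ws]; split=> [x v|x u|x u|u v].
- by move=> c u u'; rewrite !fctE wl opprD mulrN.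
- by move=> c v v'; rewrite !fctE wr opprD mulrN.
- by rewrite !fctE w0 oppr0.
- exact: smooth_funN.
Qed.

Lemma Omega20 : Omega2 (0 : form2 R N).
Proof.
split=> [x v|x u|x u|u v] //; try by move=> c u' v'; rewrite mulr0 addr0.
exact: smooth_fun_cst.
Qed.

Lemma Omega2_pullback F (w : form2 R N) :
  smooth_map F -> Omega2 w -> Omega2 (pullback F w).
Proof.
move=> sF [wl wr w0 ws]; rewrite /pullback; split=> [x v|x u|x u|u v].
- by move=> c u u'; rewrite mulmxDr -scalemxAr wl.
- by move=> c v v'; rewrite mulmxDr -scalemxAr wr.
- exact: w0.
(* The arguments of [w] vary with [x], while smoothness of [w] is given on constant vectors only;
   expansion in the standard basis moves the dependence on [x] into smooth coefficients. *)
have -> : (fun x => w (F x) (torus_jacobian F x *m u) (torus_jacobian F x *m v)) =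
  (fun x => \sum_i (torus_jacobian F x *m u) i 0 *
    \sum_j (torus_jacobian F x *m v) j 0 *
      w (F x) (delta_mx i 0) (delta_mx j 0)).
  apply/funext => x; rewrite (scalar_sum_delta _ _ (wl _ _)).
  by apply: eq_bigr => i _; rewrite (scalar_sum_delta _ _ (wr _ _)).
have sJ i t : smooth_fun (fun x => (torus_jacobian F x *m t : V) i 0).
  under eq_fun do rewrite mxE; apply: smooth_fun_sum => k.
  by apply: smooth_funM; [exact: smooth_torus_jacobian|exact: smooth_fun_cst].
apply: smooth_fun_sum => i; apply: smooth_funM => //.
apply: smooth_fun_sum => j; apply: smooth_funM => //.
exact: (smooth_fun_comp _ _ (ws _ _)).
Qed.

Lemma Omega2_cocycle F G : Diff F -> Diff G -> Omega2 (cocycle F G).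
Proof.
move=> dF dG; have [sF sG] := (Diff_smooth _ dF, Diff_smooth _ dG).
have sA : smooth_mx (torus_jacobian F \o G).
  by apply: smooth_mx_comp => //; exact: smooth_mx_jacobian.
have sB := smooth_mx_jacobian G sG.
have sA' : smooth_mx (fun x => invmx ((torus_jacobian F \o G) x)).
  exact: (smooth_mx_comp _ _ (smooth_mx_invjacobian F dF) sG).
have sB' := smooth_mx_invjacobian G dG.
split=> [x v|x u|x u|u v].
(* Both linearity lemmas occur because the second trace form has [u] and [v] exchanged. *)
- move=> c u u'; rewrite !cocycleE trace_form_linear // trace_form_linear_r //.
  by rewrite opprD addrACA -mulrBr.
- move=> c v v'; rewrite !cocycleE trace_form_linear // trace_form_linear_r //.
  by rewrite opprD addrACA -mulrBr.
- by rewrite cocycleE subrr.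
under eq_fun do rewrite cocycleE.
by apply: smooth_funD; [|apply: smooth_funN]; exact: smooth_trace_form.
Qed.

(** * Functoriality of pull-back and the cocycle identity *)

Lemma pullbackD F (w w' : form2 R N) :
  pullback F (w + w') = pullback F w + pullback F w'.
Proof. by []. Qed.

Lemma pullback_id (w : form2 R N) : pullback id w = w.
Proof.
apply/funext => x; apply/funext => u; apply/funext => v.
by rewrite /pullback torus_jacobian_id !mul1mx.
Qed.

Lemma pullback_comp F G (w : form2 R N) : smooth_map F -> smooth_map G ->
  pullback (F \o G) w = pullback G (pullback F w).
Proof.
move=> sF sG; apply/funext => x; apply/funext => u; apply/funext => v.
by rewrite /pullback torus_jacobian_comp // !mulmxA.
Qed.

(** The jacobian of the identity is constant, so its differential vanishes. *)
Lemma cocycle_id_l F : cocycle id F = 0.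
Proof.
apply/funext => x; apply/funext => u; apply/funext => v; rewrite cocycleE.
have -> : torus_jacobian (id : T -> T) \o F = (fun=> 1%:M).
  by apply/funext => y /=; rewrite torus_jacobian_id.
by rewrite !trace_form_cst_l subrr.
Qed.

Lemma cocycle_id_r F : cocycle F id = 0.
Proof.
apply/funext => x; apply/funext => u; apply/funext => v; rewrite cocycleE.
have -> : torus_jacobian (id : T -> T) = (fun=> 1%:M).
  by apply/funext => y /=; rewrite torus_jacobian_id.
by rewrite !trace_form_cst_r subrr.
Qed.

Lemma cocycle_identity F G H : Diff F -> Diff G -> Diff H ->
  pullback H (cocycle F G) + cocycle (F \o G) H =
    cocycle G H + cocycle F (G \o H).
Proof.
move=> dF dG dH.
have [sF sG sH] := And3 (Diff_smooth _ dF) (Diff_smooth _ dG) (Diff_smooth _ dH).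
apply/funext => x; apply/funext => u; apply/funext => v.
pose A := torus_jacobian F \o (G \o H); pose B := torus_jacobian G \o H.
pose C := torus_jacobian H.
have sA : smooth_mx A.
  by apply: smooth_mx_comp (smooth_mx_jacobian _ sF) _; exact: smooth_map_comp.
have sB : smooth_mx B by apply: smooth_mx_comp (smooth_mx_jacobian _ sG) sH.
have sC := smooth_mx_jacobian _ sH : smooth_mx C.
rewrite !fctE !cocycleE /pullback cocycleE.
have sFG : smooth_mx (torus_jacobian F \o G).
  exact: smooth_mx_comp (smooth_mx_jacobian _ sF) sG.
have sGJ := smooth_mx_jacobian G sG.
(* This turns the pulled-back cocycle into trace forms of [A] and [B] at [x] itself. *)
have tH := trace_form_comp _ _ H x _ _ sFG sGJ sH.
rewrite -(tH u v) -(tH v u).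
have -> : torus_jacobian (F \o G) \o H = (fun x => A x *m B x).
  by apply/funext => y; rewrite /= torus_jacobian_comp.
have -> : torus_jacobian (G \o H) = (fun x => B x *m C x).
  by apply/funext => y; rewrite /= torus_jacobian_comp.
have id3 s t := trace_form_cocycle A B C x s t sA sB sC
  (Diff_jacobian_unit _ _ dF) (Diff_jacobian_unit _ _ dG)
  (Diff_jacobian_unit _ _ dH).
(* Each side is regrouped as its part in [u v] minus its part in [v u], and the trace identity
   settles both parts. *)
rewrite [LHS]addrACA [RHS]addrACA -[in LHS]opprD -[in RHS]opprD.
by congr (_ - _); exact: id3.
Qed.

End Torus.

(** * The groups and the extension *)

(** If x y = e and y z = e, then z = (x y) z = x (y z) = x, so y is also a left inverse of x. For
    [ext_mul] this saves a second cocycle computation. *)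
Lemma is_group_right_inverse (U : Type) (A : set U) (op : U -> U -> U) (e : U) :
  (forall x y, A x -> A y -> A (op x y)) ->
  (forall x y z, A x -> A y -> A z -> op (op x y) z = op x (op y z)) ->
  is_identity A op e ->
  (forall x, A x -> exists2 y, A y & op x y = e) ->
  is_group A op.
Proof.
move=> Aop opA [Ae eP] invP; split=> //; exists e; split=> // x Ax.
have [y Ay xy] := invP x Ax; have [z Az yz] := invP y Ay.
exists y; split=> //; suff <- : z = x by [].
have [ez _] := eP z Az; have [_ xe] := eP x Ax.
by rewrite -ez -xy opA // yz xe.
Qed.

Section Extension.
Context {R : realType} {N : nat}.
Implicit Types (F G : torus R N -> torus R N) (w : form2 R N).

Lemma Diff_group :
  is_group (Diff : set (torus R N -> torus R N)) (fun F G => F \o G).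
Proof.
apply: (is_group_right_inverse _ _ _ id) => //.
- exact: Diff_comp.
- by split=> //; exact: Diff_id.
- by move=> F dF; have [F' [dF' _ FF']] := Diff_inv F dF; exists F'.
Qed.

Lemma Omega2_group : is_abelian_group (Omega2 : set (form2 R N)) +%R.
Proof.
split; last by move=> w w' _ _; exact: addrC.
apply: (is_group_right_inverse _ _ _ 0) => //.
- exact: Omega2D.
- by move=> w w' w'' _ _ _; rewrite addrA.
- by split=> [|w _]; [exact: Omega20|rewrite add0r addr0].
- by move=> w Ow; exists (- w); [exact: Omega2N|rewrite subrr].
Qed.

Lemma ext_mul_group : is_group (Diff `*` Omega2) (@ext_mul R N).
Proof.
apply: (is_group_right_inverse _ _ _ (id, 0)).
- move=> [F a] [G b] [/= dF Oa] [/= dG Ob]; split; first exact: Diff_comp.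
  apply: Omega2D; last exact: Omega2_cocycle.
  by apply: Omega2D => //; apply: Omega2_pullback => //; exact: Diff_smooth.
- move=> [F a] [G b] [H c] [/= dF _] [/= dG _] [/= dH _].
  congr pair => /=; rewrite !pullbackD pullback_comp; try exact: Diff_smooth.
  (* Here [t], [y], [z], [w] stand for the four cocycle terms; [r], [s], [k] come from the forms
     [a], [b], [c] and match on both sides. *)
  have rearrange (W : zmodType) (r s t k y z w : W) : t + y = z + w ->
      r + s + t + k + y = r + (s + k + z) + w.
    by move=> tyzw; rewrite -!addrA [t + _]addrCA tyzw.
  exact: (rearrange (form2 R N)) (cocycle_identity _ _ _ dF dG dH).
- split=> [|[F a] [/= dF _]]; first by split; [exact: Diff_id|exact: Omega20].
  rewrite /ext_mul /= cocycle_id_l cocycle_id_r pullback_id !addr0.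
  split=> //.
  (* [pullback F 0] is [0] by conversion. *)
  by rewrite add0r.
- move=> [F a] [/= dF Oa]; have [F' [dF' _ FF']] := Diff_inv F dF.
  (* The second component solves [pullback F' a + beta + cocycle F F' = 0] for [beta]. *)
  exists (F', - (pullback F' a + cocycle F F')).
    split=> //=; apply: Omega2N; apply: Omega2D; last exact: Omega2_cocycle.
    by apply: Omega2_pullback => //; exact: Diff_smooth.
  by rewrite /ext_mul /= FF' addrAC subrr.
Qed.

End Extension.

Theorem theorem3p2 (R : realType) (N : nat) (hN : (0 < N)%N) :
  is_group (Diff `*` Omega2) (@ext_mul R N) /\
  is_extension
    (Omega2 : set (form2 R N)) +%R
    (Diff `*` Omega2) ext_mul
    (Diff : set (torus R N -> torus R N)) (fun F G => F \o G)
    (fun alpha => (id, alpha)) fst.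
Proof.
split; first exact: ext_mul_group.
split.
- exact: Omega2_group.
- exact: ext_mul_group.
- exact: Diff_group.
- split=> [w Ow|w w' _ _]; first by split=> //; exact: Diff_id.
  by rewrite /ext_mul /= cocycle_id_l pullback_id addr0.
- by split=> [[F w] []|].
- by move=> w w' _ _ [].
- apply/seteqP; split=> [_ [w Ow <-]|[F w] [[/= dF Ow] [_ idF]]].
    split; first by split=> //; exact: Diff_id.
    by split=> [|F _] //; exact: Diff_id.
  (* The identity property of [F], tested on [id], gives [F \o id = id], that is [F = id]. *)
  by exists w => //; congr pair; have [] := idF id Diff_id.
- apply/seteqP; split=> [_ [[F w] [/= dF _] <-] //|F dF].
  by exists (F, 0) => //; split=> //; exact: Omega20.
Qed.
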